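(* Let $H=(V,\mathcal{E})$ be a 3-uniform hypergraph with $V=\{v_1,\dots,v_{2n+1}\}$, $\vec H$ an orientation of $H$, and $A$ the matrix defined below, whose lines are identified with the hyperedges. Then for each $r\in\{1,\dots,|V|\}$, the parity bases of $(A^{(r)},\mathcal E)$ are exactly the spanning hypertrees of $H$. In addition, if $\vec H$ is 3-Pfaffian, then $(A^{(r)},\mathcal E)$ is a Pfaffian parity with constant $(-1)^{r-1}\operatorname{sgn}\vec T$, where $T$ is an arbitrary spanning hypertree of $H$.
   Context: $\mathcal E$ is a set of 3-element subsets (hyperedges) of $V$. A path between $s,t$ is an alternating sequence $s=u_0,e_1,u_1,\dots,e_l,u_l=t$ of distinct vertices and distinct hyperedges with $\{u_{i-1},u_i\}\subseteq e_i$; a cycle is such a sequence with $u_0=u_l$, $l\ge 2$. A hyperedge set $F$ is connected if any two vertices lying in hyperedges of $F$ are joined by a path in $F$; a hypertree is a connected hyperedge set with no cycle, spanning if it covers all of $V$. An orientation assigns to each $e$ an ordered triple $\vec e=(v_i,v_j,v_k)$; $\sigma_{\vec e}=(i\;j\;k)$. For a spanning hypertree $T$ the product of the $\sigma_{\vec e}$ ($e\in T$) in any order is a cyclic permutation $(s_1\;\cdots\;s_{2n+1})$, and $\operatorname{sgn}\vec T$ is the sign of $i\mapsto s_i$ (well defined, by Masbaum–Vaintrob). $\vec H$ is 3-Pfaffian if $\operatorname{sgn}\vec T$ is the same for all spanning hypertrees $T$. The matrix $A$ is the incidence matrix ($+1$ tail, $-1$ head) of the directed multigraph having arcs $(v_i,v_j),(v_i,v_k)$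 for each $\vec e=(v_i,v_j,v_k)$, with row $i$ indexed by $v_i$ and these two columns consecutive in this order, forming the line of $e$; $A^{(r)}$ is $A$ without row $r$. A parity base of $(A^{(r)},\mathcal E)$ is a set of lines whose columns form a nonsingular square submatrix $A^{(r)}[B]$ (original column order); $(A^{(r)},\mathcal E)$ is a Pfaffian parity with constant $c\ne0$ if $\det A^{(r)}[B]=c$ for all parity bases $B$. *)

(* Defs.v *)
From mathcomp Require Import all_boot all_order all_algebra all_fingroup.

Set Implicit Arguments.
Unset Strict Implicit.
Unset Printing Implicit Defensive.

Import GRing.Theory.
Local Open Scope ring_scope.

Definition uniform3 (V : finType) (E : {set {set V}}) : Prop :=
  forall e, e \in E -> #|e| = 3%N.

(* The alternating sequence u_0, e_1, u_1, ..., e_l, u_l is encoded by its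
   first vertex u_0 = u and the list p = [:: (e_1, u_1); ...; (e_l, u_l)]. *)
Fixpoint hwalk (V : finType) (F : {set {set V}}) (u : V)
    (p : seq ({set V} * V)) : bool :=
  if p is (e, v) :: p' then [&& e \in F, [set u; v] \subset e & hwalk F v p']
  else true.

Definition hpath (V : finType) (F : {set {set V}}) (s t : V)
    (p : seq ({set V} * V)) : Prop :=
  [/\ hwalk F s p, last s (unzip2 p) = t,
      uniq (s :: unzip2 p) & uniq (unzip1 p)].

(* Here u_l = s, so uniq (unzip2 p) says that u_0, ..., u_(l-1) are distinct. *)
Definition hcycle (V : finType) (F : {set {set V}}) (s : V)
    (p : seq ({set V} * V)) : Prop :=
  [/\ hwalk F s p, last s (unzip2 p) = s, (2 <= size p)%N,
      uniq (unzip2 p) & uniq (unzip1 p)].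

Definition hconnected (V : finType) (F : {set {set V}}) : Prop :=
  forall s t, s \in cover F -> t \in cover F -> exists p, hpath F s t p.

Definition hypertree (V : finType) (F : {set {set V}}) : Prop :=
  hconnected F /\ ~ (exists s p, hcycle F s p).

Definition spanning_hypertree (V : finType) (E T : {set {set V}}) : Prop :=
  [/\ T \subset E, hypertree T & cover T = [set: V]].

(* o e = (v_i, v_j, v_k); the values of o outside E are irrelevant. *)
Definition is_orientation (V : finType) (E : {set {set V}})
    (o : {set V} -> V * V * V) : Prop :=
  forall e, e \in E -> e = [set (o e).1.1; (o e).1.2; (o e).2].

(* mathcomp composes permutations from left to right, so for distinct i, j, k
   this is the 3-cycle i |-> j |-> k |-> i. *)
Definition sigma (V : finType) (o : {set V} -> V * V * V) (e : {set V}) :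
    {perm V} :=
  let '(i, j, k) := o e in (tperm i j * tperm i k)%g.

(* c is the cyclic permutation (s_0 s_1 ... s_(N-1)). *)
Definition is_cyclic_form (N : nat) (c s : 'S_N) : bool :=
  [forall i, c (s i) == s (ordS i)].

(* An arbitrary ordering x.1 of T and an arbitrary cyclic notation x.2 of the
   product are picked; for spanning hypertrees one exists and the sign does not
   depend on the choice (Masbaum-Vaintrob). The value 1 is a dummy. *)
Definition hypertree_sgn (n : nat)
    (o : {set 'I_n.*2.+1} -> 'I_n.*2.+1 * 'I_n.*2.+1 * 'I_n.*2.+1)
    (T : {set {set 'I_n.*2.+1}}) : int :=
  if [pick x : #|T|.-tuple {set 'I_n.*2.+1} * 'S_(n.*2.+1) |
       perm_eq x.1 (enum T) &&
       is_cyclic_form (\prod_(e <- x.1) sigma o e)%g x.2] is Some x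
  then (-1) ^+ odd_perm x.2 else 1.

Definition three_pfaffian (n : nat) (E : {set {set 'I_n.*2.+1}})
    (o : {set 'I_n.*2.+1} -> 'I_n.*2.+1 * 'I_n.*2.+1 * 'I_n.*2.+1) : Prop :=
  forall T T', spanning_hypertree E T -> spanning_hypertree E T' ->
    hypertree_sgn o T = hypertree_sgn o T'.

(* enum_val lists the columns of S in increasing order. *)
Definition col_submx (K : fieldType) (p q : nat) (M : 'M[K]_(p, q))
    (S : {set 'I_q}) : 'M[K]_(p, #|S|) :=
  colsub (fun j : 'I_#|S| => enum_val j) M.

(* line l is the set of column indices forming the line labelled l. *)
Definition line_cols (q : nat) (L : finType) (line : L -> {set 'I_q})
    (B : {set L}) : {set 'I_q} :=
  \bigcup_(l in B) line l.

Definition line_submx (K : fieldType) (p q : nat) (M : 'M[K]_(p, q))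
    (L : finType) (line : L -> {set 'I_q}) (B : {set L})
    (sq : #|line_cols line B| = p) : 'M[K]_p :=
  castmx (erefl p, sq) (col_submx M (line_cols line B)).

Definition parity_base (K : fieldType) (p q : nat) (M : 'M[K]_(p, q))
    (L : finType) (line : L -> {set 'I_q}) (L0 B : {set L}) : Prop :=
  B \subset L0 /\
  exists sq : #|line_cols line B| = p, line_submx M sq \in unitmx.

Definition pfaffian_parity (K : fieldType) (p q : nat) (M : 'M[K]_(p, q))
    (L : finType) (line : L -> {set 'I_q}) (L0 : {set L}) (c : K) : Prop :=
  c != 0 /\
  forall B, parity_base M line L0 B ->
    forall sq : #|line_cols line B| = p, \det (line_submx M sq) = c.

(* es lists the hyperedges; the one at position l (from 0) owns the consecutive
   columns 2l, for the arc (v_i, v_j), and 2l+1, for the arc (v_i, v_k). *)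
Definition col_arc (N : nat) (o : {set 'I_N} -> 'I_N * 'I_N * 'I_N)
    (es : seq {set 'I_N}) (c : 'I_(size es).*2) : 'I_N * 'I_N :=
  let '(i, j, k) := o (nth set0 es c./2) in (i, if odd c then k else j).

Definition incidence (K : fieldType) (N : nat)
    (o : {set 'I_N} -> 'I_N * 'I_N * 'I_N) (es : seq {set 'I_N}) :
    'M[K]_(N, (size es).*2) :=
  \matrix_(i, c) ((i == (col_arc o c).1)%:R - (i == (col_arc o c).2)%:R).

Definition hyperedge_line (N : nat) (es : seq {set 'I_N}) (e : {set 'I_N}) :
    {set 'I_(size es).*2} :=
  [set c : 'I_(size es).*2 | nth set0 es c./2 == e].

(* Main.v *)
Require Import Defs.
From mathcomp Require Import all_boot all_order all_algebra all_fingroup.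
From mathcomp Require Import zify ring.

Set Implicit Arguments.
Unset Strict Implicit.
Unset Printing Implicit Defensive.

Import GRing.Theory.
Local Open Scope ring_scope.

(* The columns of A^(r)[B] are independent iff B has no cycle: at each vertex
   and in each hyperedge of a dependency the weights sum to zero, so a walk
   through nonzero weights never gets stuck and closes up, and conversely a
   cycle carries such weights. The rows are independent iff B is connected and
   spanning, since a left null vector of A[B] is a function that is constant on
   every hyperedge.

   For the value of the determinant, prepend the basis vector of r to the
   columns of A[T] and let T be built in any order of its hyperedges. Counting
   incidences gives a leaf, a hyperedge (i, j, k) (up to rotation) with j and k
   in no other hyperedge. Removing it removes j, k from the cyclic permutation,
   where they follow one another. In the determinant the two columns e_i - e_j,
   e_i - e_k reduce to -e_j, -e_k, and a block of two columns moves freely.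
   By induction the determinant is that of e_(s_1), ..., e_(s_(2n+1)). *)

(** * Determinants of lists of rows *)

Section ListDeterminant.
Variables (K : fieldType) (N : nat).
Implicit Types (a b : 'rV[K]_N) (X Y Z T : seq 'rV[K]_N).

(* Lists of the wrong length get the value 0, so that the rules below hold
   for all lists. *)
Definition rows_det X : K :=
  if size X == N then \det (\matrix_(i < N) nth 0 X i) else 0.

Lemma rows_detD X Y a b :
  rows_det (X ++ (a + b) :: Y) = rows_det (X ++ a :: Y) + rows_det (X ++ b :: Y).
Proof.
rewrite /rows_det !size_cat /=; case: eqP => [sz|_]; last by rewrite addr0.
have ltXN : (size X < N)%N by move: sz; lia.
pose i0 := Ordinal ltXN.
have row_i0 c : row i0 (\matrix_(i < N) nth 0 (X ++ c :: Y) i) = c.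
  by rewrite rowK nth_cat ltnn subnn.
have row'_i0 c d : row' i0 (\matrix_(i < N) nth 0 (X ++ c :: Y) i) =
                   row' i0 (\matrix_(i < N) nth 0 (X ++ d :: Y) i).
  apply/row_matrixP => i; rewrite !row_rowsub !rowK !nth_cat.
  case: ltnP => // le; have : lift i0 i != i0 by rewrite eq_sym neq_lift.
  rewrite -val_eqE /= => ne.
  (* Past row [i0] the index into [c :: Y] is a successor, so [nth] skips the replaced head. *)
  have -> // : (bump (size X) i - size X =
                (bump (size X) i - size X).-1.+1)%N.
  by move: ne le => /=; lia.
rewrite -[X in _ = X + _]mul1r -[X in _ = _ + X]mul1r.
by apply: (@determinant_multilinear _ _ _ _ _ i0); rewrite ?scale1r ?row_i0 //; apply: row'_i0.
Qed.

Lemma rows_det_dup X Y Z a : rows_det (X ++ a :: Y ++ a :: Z) = 0.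
Proof.
rewrite /rows_det; case: eqP => // sz.
have lt1 : (size X < N)%N by move: sz; rewrite size_cat /= ?size_cat /=; lia.
have lt2 : (size X + (size Y).+1 < N)%N.
  by move: sz; rewrite size_cat /= ?size_cat /=; lia.
apply: (@determinant_alternate _ _ _ (Ordinal lt1) (Ordinal lt2)).
  by rewrite -val_eqE /=; lia.
move=> j; rewrite !mxE !nth_cat /= ltnn subnn.
by rewrite ifN 1?addKn /= ?nth_cat ?ltnn ?subnn //; lia.
Qed.

Lemma rows_det_dup_adj X Y a : rows_det (X ++ a :: a :: Y) = 0.
Proof. exact: (rows_det_dup X [::]). Qed.

Lemma rows_detN X Y a : rows_det (X ++ (- a) :: Y) = - rows_det (X ++ a :: Y).
Proof.
have D0 : rows_det (X ++ 0 :: Y) = 0.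
  by have /eqP := rows_detD X Y 0 0; rewrite addr0 eq_sym -subr_eq0 addrK => /eqP.
by apply/eqP; rewrite -addr_eq0 addrC -rows_detD subrr D0.
Qed.

(** Polarisation: expand the vanishing value at two adjacent copies of [a + b]. *)
Lemma rows_det_swap X Y a b :
  rows_det (X ++ a :: b :: Y) = - rows_det (X ++ b :: a :: Y).
Proof.
have := rows_det_dup_adj X Y (a + b).
have D2 c : rows_det (X ++ c :: (a + b) :: Y) =
    rows_det (X ++ c :: a :: Y) + rows_det (X ++ c :: b :: Y).
  by rewrite -!(cat_rcons c); apply: rows_detD.
by rewrite rows_detD !D2 !rows_det_dup_adj add0r addr0 => /eqP;
  rewrite addr_eq0 => /eqP.
Qed.

Lemma rows_det_move X Y Z a :
  rows_det (X ++ a :: Y ++ Z) = (-1) ^+ size Y * rows_det (X ++ Y ++ a :: Z).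
Proof.
elim: Y X => [|b Y IH] X; first by rewrite mul1r.
by rewrite /= rows_det_swap -cat_rcons IH cat_rcons exprS mulN1r mulNr.
Qed.

Lemma rows_det_catC X Y Z T :
  rows_det (X ++ Y ++ Z ++ T) =
  (-1) ^+ (size Y * size Z) * rows_det (X ++ Z ++ Y ++ T).
Proof.
elim: Y X => [|a Y IH] X; first by rewrite mul1r.
rewrite /= -cat_rcons IH cat_rcons rows_det_move mulrA -exprD.
by congr (_ * _); congr (_ ^+ _); lia.
Qed.

(** Applied to the two rows of a hyperedge, which form an even block and so move without a sign. *)
Lemma rows_det_catC_even X Y Z T : ~~ odd (size Y) || ~~ odd (size Z) ->
  rows_det (X ++ Y ++ Z ++ T) = rows_det (X ++ Z ++ Y ++ T).
Proof.
by move=> ev; rewrite rows_det_catC -signr_odd oddM; case/orP: ev => /negPf->;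
  rewrite ?andbF mul1r.
Qed.

(** A rotation exchanges two blocks of odd total length, one of which is even. Hence the starting
    point of a cyclic notation of odd length does not matter. *)
Lemma rows_det_rot X Y m : odd (size Y) ->
  rows_det (X ++ rot m Y) = rows_det (X ++ Y).
Proof.
move=> oddY; have := @rows_det_catC_even X (drop m Y) (take m Y) [::].
rewrite !cats0 cat_take_drop => -> //.
by move: oddY; rewrite -{1}(cat_take_drop m Y) size_cat oddD; do 2!case: odd.
Qed.

Lemma rows_det_addl X Y a b : b \in X ++ Y ->
  rows_det (X ++ (a + b) :: Y) = rows_det (X ++ a :: Y).
Proof.
move=> mem; rewrite rows_detD -[RHS]addr0; congr (_ + _).
move: mem; rewrite mem_cat => /orP[] /splitPr[Z T]; last exact: rows_det_dup.
by rewrite -catA; apply: rows_det_dup.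
Qed.

End ListDeterminant.

(** * Hypertrees as lists of triples *)

Section Triples.
Variable V : finType.
Implicit Types (t : V * V * V) (L : seq (V * V * V)) (W : {set V}).

Definition triple_seq t : seq V := [:: t.1.1; t.1.2; t.2].

(** Rotations change neither the 3-cycle nor the determinant, so the two degree-1 vertices of a leaf
    may be assumed to come last. *)
Definition triple_rot t := (t.1.2, t.2, t.1.1).

(** The formula of [sigma] on a bare triple, so that the induction can work with lists of triples
    alone. *)
Definition triple_perm t : {perm V} :=
  let '(i, j, k) := t in (tperm i j * tperm i k)%g.

Definition triples_perm L : {perm V} := (\prod_(t <- L) triple_perm t)%g.

Definition degree L v := count (fun t => v \in triple_seq t) L.

Definition same_on t (f : V -> bool) := f t.1.1 = f t.1.2 /\ f t.1.1 = f t.2.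

(** Connectedness is stated through Boolean functions, which extend easily over a removed leaf; the
    vertex count takes the place of acyclicity. *)
Definition hypertree_on L W : Prop :=
  [/\ {in L, forall t, uniq (triple_seq t) /\ {subset triple_seq t <= W}},
      #|W| = (size L).*2.+1
    & forall f : V -> bool, {in L, forall t, same_on t f} ->
        {in W &, forall u v, f u = f v}].

Lemma mem_triple_rot t : triple_seq (triple_rot t) =i triple_seq t.
Proof. by move=> v; rewrite !inE orbA orbC. Qed.

Lemma same_on_rot t f : same_on (triple_rot t) f -> same_on t f.
Proof. by case=> /= e1 e2; rewrite /same_on -e2 -e1. Qed.

Lemma triple_perm_rot t : uniq (triple_seq t) ->
  triple_perm (triple_rot t) = triple_perm t.
Proof.
case: t => -[i j] k; rewrite /= !inE negb_or => /and3P[/andP[ij ik] jk _].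
rewrite /triple_rot /=; apply/permP => v; rewrite !permM.
have [ji ki kj] : [/\ j != i, k != i & k != j] by rewrite !(eq_sym _ i) (eq_sym k).
have [->|vi] := eqVneq v i.
  by rewrite (tpermD ji ki) tpermR tpermL (tpermD ij kj).
have [->|vj] := eqVneq v j.
  by rewrite tpermL (tpermD jk ik) tpermR tpermL.
have [->|vk] := eqVneq v k.
  by rewrite tpermR tpermL (tpermD ik jk) tpermR.
by rewrite !tpermD // eq_sym.
Qed.

Lemma hypertree_on_rot L1 t L2 W : hypertree_on (L1 ++ t :: L2) W ->
  hypertree_on (L1 ++ triple_rot t :: L2) W.
Proof.
case=> wf card conn; split; first 2 last.
- move=> f fP; apply: conn => u; rewrite mem_cat inE => uL.
  case/or3P: uL => uL; try by apply: fP; rewrite mem_cat inE uL ?orbT.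
  by rewrite (eqP uL); apply: same_on_rot; apply: fP; rewrite mem_cat inE eqxx orbT.
- move=> u; rewrite mem_cat inE => uL.
  case/or3P: uL => uL; try by apply: wf; rewrite mem_cat inE uL ?orbT.
  have [|uniqt subt] := wf t; first by rewrite mem_cat inE eqxx orbT.
  rewrite (eqP uL); split; last by move=> v; rewrite mem_triple_rot; apply: subt.
  by move: uniqt; rewrite -(rot_uniq 1).
- by rewrite card !size_cat.
Qed.

(** Double counting of the incidences between vertices and triples, weighted by [g]. *)
Lemma sum_degree L W (g : V -> nat) :
  {in L, forall t, uniq (triple_seq t) /\ {subset triple_seq t <= W}} ->
  (\sum_(v in W) g v * degree L v = \sum_(t <- L) \sum_(v <- triple_seq t) g v)%N.
Proof.
elim: L => [|t L IH] wf.
  by rewrite big_nil big1 // => v _; rewrite muln0.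
rewrite big_cons -IH; last by move=> u uL; apply: wf; rewrite inE uL orbT.
have [uniqt subt] := wf t (mem_head _ _).
rewrite (eq_bigr (fun v =>
  (g v * (v \in triple_seq t) + g v * degree L v)%N)); last first.
  by move=> v _; rewrite /degree /= mulnDr.
rewrite big_split /=; congr (_ + _)%N.
rewrite (big_uniq _ uniqt) /= [RHS]big_mkcond [LHS]big_mkcond /=.
apply: eq_bigr => v _; case: (boolP (v \in triple_seq t)) => [vt|_].
  by rewrite (subt _ vt) muln1.
by rewrite muln0 if_same.
Qed.

(* There are 3|L| incidences for 2|L|+1 vertices, each of degree at least 1 by
   connectedness, so more than |L| vertices have degree 1 and two of them lie
   in the same triple. *)
Lemma exists_leaf L W : hypertree_on L W -> L != [::] ->
  exists2 t, t \in L &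
    [|| (degree L t.1.2 == 1) && (degree L t.2 == 1),
        (degree L t.2 == 1) && (degree L t.1.1 == 1)
      | (degree L t.1.1 == 1) && (degree L t.1.2 == 1)]%N.
Proof.
move=> [wf card conn] L0; apply/hasP; apply: contraT => /hasPn noleaf.
have deg_gt0 v : v \in W -> (0 < degree L v)%N.
  move=> vW; rewrite -has_count; apply: contraT => /hasPn isol.
  have far t : t \in L -> v \notin triple_seq t by apply: isol.
  have [x] : exists x, x \in W :\ v.
    apply/set0Pn; rewrite -card_gt0; have := cardsD1 v W; rewrite vW card add1n => -[<-].
    by rewrite double_gt0 lt0n size_eq0.
  rewrite !inE => /andP[xv xW].
  (* If [v] is isolated, its indicator is constant on every triple and yet separates [v] from
     [x]. *)
  have /(_ x v xW vW) : {in W &, forall u w, (u == v) = (w == v)}.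
    apply: (conn (fun u => u == v)) => t /far; rewrite !inE !negb_or /same_on.
    by rewrite -!(eq_sym v) => /and3P[/negPf-> /negPf-> /negPf->].
  by rewrite eqxx (negPf xv).
(* Weight 2 in degree 1 and weight 1 otherwise: each vertex contributes at least 2, while a triple
   without two degree-1 vertices contributes at most 4. This would give 2(2|L|+1) <= 4|L|. *)
pose g v := (degree L v == 1%N).+1.
have lower : (2 * #|W| <= \sum_(v in W) g v * degree L v)%N.
  rewrite -sum1_card big_distrr /=; apply: leq_sum => v /deg_gt0 /=.
  by rewrite /g; case: (degree L v) => [|[|d]] //=; lia.
have upper : (\sum_(v in W) g v * degree L v <= \sum_(t <- L) 4)%N.
  rewrite sum_degree //; rewrite big_seq [leqRHS]big_seq; apply: leq_sum => t /noleaf.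
  rewrite /triple_seq !big_cons big_nil /g.
  by do 3!case: eqP.
by have := leq_trans lower upper; rewrite card big_const_seq count_predT iter_addn; lia.
Qed.

Lemma degree1_split L1 t L2 v : v \in triple_seq t ->
  degree (L1 ++ t :: L2) v = 1%N ->
  {in L1 ++ L2, forall u, v \notin triple_seq u}.
Proof.
rewrite /degree count_cat /= => ->; rewrite add1n addnS => -[deg0] u.
have : ~~ has (fun t => v \in triple_seq t) (L1 ++ L2).
  by rewrite has_count count_cat deg0.
by move/hasPn; apply.
Qed.

Lemma hypertree_on_prune L1 i j k L2 W : hypertree_on (L1 ++ (i, j, k) :: L2) W ->
  {in L1 ++ L2, forall u, j \notin triple_seq u} ->
  {in L1 ++ L2, forall u, k \notin triple_seq u} ->
  hypertree_on (L1 ++ L2) (W :\ j :\ k).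
Proof.
move=> [wf card conn] jL kL.
have [|uniqt subt] := wf (i, j, k); first by rewrite mem_cat inE eqxx orbT.
have inW v : v \in [:: i; j; k] -> v \in W by apply: subt.
move: uniqt; rewrite /= !inE negb_or => /and3P[/andP[ij ik] jk _].
have wf' t : t \in L1 ++ L2 -> t \in L1 ++ (i, j, k) :: L2.
  by rewrite !mem_cat inE => /orP[]->; rewrite ?orbT.
split.
- move=> t tL; have [ut st] := wf t (wf' t tL); split=> // v vt.
  rewrite !inE (st v vt) andbT; apply/andP; split; apply: contraTneq vt => ->;
  [exact: kL | exact: jL].
- have := cardsD1 j W; have := cardsD1 k (W :\ j).
  by rewrite !inE (eq_sym k) jk !inW ?inE ?eqxx ?orbT // card !size_cat /=; lia.
move=> f fP u v; rewrite !inE => /and3P[uk uj uW] /and3P[vk vj vW].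
(* With the value of [f] at [i] on both [j] and [k], the extension is constant on the removed triple
   as well. *)
pose f' w := if (w == j) || (w == k) then f i else f w.
have /(_ u v uW vW) : {in W &, forall u v, f' u = f' v}; last first.
  by rewrite /f' (negPf uk) (negPf uj) (negPf vk) (negPf vj).
apply: conn => t; rewrite mem_cat inE => tL.
have [/eqP->|tn] := boolP (t == (i, j, k)).
  by rewrite /same_on /f' /= !eqxx orbT (negPf ij) (negPf ik).
have {tn}tL : t \in L1 ++ L2 by rewrite mem_cat; move: tL; rewrite (negPf tn).
have := fP t tL; have := jL t tL; have := kL t tL.
rewrite /same_on /f' /triple_seq !inE !negb_or -!(eq_sym j) -!(eq_sym k).
by do 2!case/and3P=> /negPf-> /negPf-> /negPf->.
Qed.

(** * Cyclic permutations and the insertion of a leaf *)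

Lemma path_frel_eq (f g : V -> V) x s y : path (frel f) x (rcons s y) ->
  {in x :: s, f =1 g} -> path (frel g) x (rcons s y).
Proof.
elim: s x => [|z s IH] x /=; first by rewrite !andbT => /eqP<- ->; rewrite ?mem_head.
case/andP=> /eqP <- p fg; rewrite fg ?mem_head // eqxx /= -fg ?mem_head //.
by apply: IH => // u us; apply: fg; rewrite inE us orbT.
Qed.

Lemma triples_perm_id L v : {in L, forall t, v \notin triple_seq t} ->
  triples_perm L v = v.
Proof.
rewrite /triples_perm; elim: L => [|t L IH] H; first by rewrite big_nil perm1.
rewrite big_cons permM.
have -> : triple_perm t v = v.
  have := H t (mem_head _ _); case: t {H} => -[i j] k; rewrite !inE !negb_or /=.
  by rewrite permM => /and3P[*]; rewrite !tpermD // eq_sym.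
by apply: IH => u uL; apply: H; rewrite inE uL orbT.
Qed.

Lemma triple_permE i j k : uniq (triple_seq (i, j, k)) ->
  [/\ triple_perm (i, j, k) i = j, triple_perm (i, j, k) j = k
    & triple_perm (i, j, k) k = i].
Proof.
rewrite /= !inE negb_or => /and3P[/andP[ij ik] jk _].
rewrite !permM !(tpermL, tpermR) (tpermD (z := k)) ?tpermR //.
by rewrite tpermD // 1?eq_sym.
Qed.

(* Inserting the leaf (i, j, k) into the product inserts j, k after the vertex
   that the triples to the left of the leaf send to i. *)
Lemma insert_leaf_cycle L1 i j k L2 s : uniq (triple_seq (i, j, k)) ->
  {in L1 ++ L2, forall u, j \notin triple_seq u} ->
  {in L1 ++ L2, forall u, k \notin triple_seq u} ->
  uniq s -> j \notin s -> k \notin s -> i \in s ->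
  {in L1 ++ L2, forall t, {subset triple_seq t <= s}} ->
  fcycle (triples_perm (L1 ++ L2)) s ->
  exists m x s', rot m s = x :: s' /\
    fcycle (triples_perm (L1 ++ (i, j, k) :: L2)) (x :: j :: k :: s').
Proof.
move=> uniqt jL kL uniqs js ks iinS sub cyc.
have fix1 v : {in L1 ++ L2, forall u, v \notin triple_seq u} ->
    triples_perm L1 v = v /\ triples_perm L2 v = v.
  by move=> H; split; apply: triples_perm_id => u uL; apply: H; rewrite mem_cat uL ?orbT.
have [j1 j2] := fix1 j jL; have [k1 k2] := fix1 k kL.
pose x := ((triples_perm L1)^-1)%g i.
have ax : triples_perm L1 x = i by rewrite permKV.
have xs : x \in s.
  (* A point outside [s] lies in no triple and is fixed, which would make [x] equal to [i], a point
     of [s]. *)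
  apply: contraT => xs; have [x1 _] : triples_perm L1 x = x /\ triples_perm L2 x = x.
    by apply: fix1 => u uL; apply: contra xs; apply: sub.
  by rewrite -x1 ax iinS in xs.
have [m s' eqs] := rot_to xs; exists m, x, s'; split=> //.
have [ti tj tk] := triple_permE uniqt.
have {}uniqs : uniq (x :: s') by rewrite -eqs rot_uniq.
have {}cyc : fcycle (triples_perm (L1 ++ L2)) (x :: s') by rewrite -eqs rot_cycle.
have pE v : triples_perm (L1 ++ L2) v = triples_perm L2 (triples_perm L1 v).
  by rewrite /triples_perm big_cat permM.
have qE v : triples_perm (L1 ++ (i, j, k) :: L2) v =
    triples_perm L2 (triple_perm (i, j, k) (triples_perm L1 v)).
  by rewrite /triples_perm big_cat big_cons !permM.
rewrite /= !qE ax ti j1 tj k2 j2 !eqxx /=.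
have qk : triples_perm (L1 ++ (i, j, k) :: L2) k = triples_perm (L1 ++ L2) x.
  by rewrite qE k1 tk pE ax.
(* On [s'] the new factor acts trivially: the points that the left factor sends to [i], [j], [k] are
   [x], [j], [k], none of them in [s']. *)
have qEs v : v \in s' -> triples_perm (L1 ++ L2) v = triples_perm (L1 ++ (i, j, k) :: L2) v.
  move=> vs'; rewrite pE qE; congr (triples_perm L2 _).
  have vs : v \in s by rewrite -(mem_rot m) eqs inE vs' orbT.
  suff : triples_perm L1 v \notin [:: i; j; k].
    by rewrite !inE !negb_or permM => /and3P[*]; rewrite !tpermD // eq_sym.
  rewrite !inE !negb_or; apply/and3P; split.
  - rewrite -[X in _ != X]ax (inj_eq perm_inj); apply: contraTneq vs' => ->.
    by case/andP: uniqs.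
  - by rewrite -[X in _ != X]j1 (inj_eq perm_inj); apply: contraNneq js => <-.
  - by rewrite -[X in _ != X]k1 (inj_eq perm_inj); apply: contraNneq ks => <-.
case: s' qEs cyc {uniqs eqs} => [|y s'] qEs /=; first by rewrite qk.
by case/andP=> xy p; rewrite qk xy; apply: path_frel_eq p qEs.
Qed.

End Triples.

(** * The determinant of a hypertree *)

Section HypertreeDeterminant.
Variables (K : fieldType) (N : nat).
Implicit Types (t : 'I_N * 'I_N * 'I_N) (L : seq ('I_N * 'I_N * 'I_N)).
Implicit Types (W : {set 'I_N}) (X Y : seq 'rV[K]_N).

Definition basis_row (v : 'I_N) : 'rV[K]_N := delta_mx 0 v.

(** The two columns of a line, transposed, since [rows_det] takes rows. *)
Definition triple_rows t : seq 'rV[K]_N :=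
  [:: basis_row t.1.1 - basis_row t.1.2; basis_row t.1.1 - basis_row t.2].

Definition triples_rows L := flatten [seq triple_rows t | t <- L].

(* X stands for the rows that complete those of L to a square matrix. *)
Definition has_cyclic_form_det L W := exists s : seq 'I_N,
  [/\ uniq s, s =i W, fcycle (triples_perm L) s &
      forall X r, r \in W ->
        rows_det (X ++ basis_row r :: triples_rows L) =
        rows_det (X ++ map basis_row s)].

Lemma triples_rows_cat L1 L2 :
  triples_rows (L1 ++ L2) = triples_rows L1 ++ triples_rows L2.
Proof. by rewrite /triples_rows map_cat flatten_cat. Qed.

(** For a = e_i - e_j and b = e_i - e_k the rotated triple has the rows b - a and -a. Adding a row
    and swapping turns them into a and b, with the two signs cancelling. *)
Lemma rows_det_triple_rot X Y t :
  rows_det (X ++ triple_rows (triple_rot t) ++ Y) =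
  rows_det (X ++ triple_rows t ++ Y).
Proof.
case: t => -[i j] k; rewrite /triple_rows /triple_rot /=.
set a := basis_row i - basis_row j; set b := basis_row i - basis_row k.
have -> : basis_row j - basis_row k = b - a.
  by rewrite /a /b opprB [RHS]addrC addrA subrK.
have -> : basis_row j - basis_row i = - a by rewrite opprB.
rewrite rows_det_addl; last by rewrite mem_cat mem_head orbT.
by rewrite -cat_rcons rows_detN cat_rcons -rows_det_swap.
Qed.

Lemma has_cyclic_form_det_rot L1 t L2 W : uniq (triple_seq t) ->
  has_cyclic_form_det (L1 ++ triple_rot t :: L2) W ->
  has_cyclic_form_det (L1 ++ t :: L2) W.
Proof.
move=> uniqt [s [uniqs sW cyc detE]]; exists s; split=> //.
  by move: cyc; rewrite /triples_perm !big_cat !big_cons triple_perm_rot.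
move=> X r rW; rewrite -(detE X r rW) !triples_rows_cat.
have := rows_det_triple_rot (X ++ basis_row r :: triples_rows L1) (triples_rows L2) t.
by rewrite -!catA => ->.
Qed.

Lemma has_cyclic_form_det_leaf L1 i j k L2 W :
  hypertree_on (L1 ++ (i, j, k) :: L2) W ->
  {in L1 ++ L2, forall u, j \notin triple_seq u} ->
  {in L1 ++ L2, forall u, k \notin triple_seq u} ->
  has_cyclic_form_det (L1 ++ L2) (W :\ j :\ k) ->
  has_cyclic_form_det (L1 ++ (i, j, k) :: L2) W.
Proof.
move=> HW jL kL [s [uniqs sW cyc detE]].
have [wf' _ _] := hypertree_on_prune HW jL kL; have [wf _ _] := HW.
have [|uniqt subt] := wf (i, j, k); first by rewrite mem_cat inE eqxx orbT.
have [iW jW kW] : [/\ i \in W, j \in W & k \in W].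
  by split; apply: subt; rewrite !inE eqxx ?orbT.
have /and3P[/norP[ij /norP[ik _]] /norP[jk _] _] := uniqt.
have iW' : i \in W :\ j :\ k by rewrite !inE ij ik.
have jn : j \notin s by rewrite sW !inE eqxx andbF.
have kn : k \notin s by rewrite sW !inE eqxx.
have [||m [x [s' [eqs cyc']]]] := insert_leaf_cycle uniqt jL kL uniqs jn kn _ _ cyc.
- by rewrite sW.
- by move=> t tL v vt; rewrite sW; apply: (wf' t tL).2.
have mem_s v : v \in x :: s' = (v \in s) by rewrite -eqs mem_rot.
exists (x :: j :: k :: s'); split=> //.
- have := uniqs; rewrite -(rot_uniq m) eqs /= => /andP[xs' ->].
  have := mem_s j; have := mem_s k; rewrite (negPf jn) (negPf kn) !inE.
  move=> /norP[kx ks'] /norP[jx js'].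
  by rewrite !negb_or ks' js' xs' jk eq_sym jx eq_sym kx.
- move=> v; have := mem_s v; rewrite sW !inE.
  have [->|vj] := eqVneq v j; first by rewrite jW orbT.
  have [->|vk] := eqVneq v k; first by rewrite kW !orbT.
  by [].
(* First the case of a prepended vertex that survives the removal of the leaf, to which the
   induction hypothesis applies. *)
have main X r : r \in W :\ j :\ k ->
  rows_det (X ++ basis_row r :: triples_rows (L1 ++ (i, j, k) :: L2)) =
  rows_det (X ++ map basis_row [:: x, j, k & s']).
- move=> rW.
  have -> : rows_det (X ++ basis_row r :: triples_rows (L1 ++ (i, j, k) :: L2)) =
      rows_det ((X ++ triple_rows (i, j, k)) ++ basis_row r :: triples_rows (L1 ++ L2)).
    rewrite !triples_rows_cat -catA.
    (* The two leaf rows move to the front and join [X], which is why the hypothesis is stated for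
       every [X]. *)
    apply: (@rows_det_catC_even _ _ X (basis_row r :: triples_rows L1)
      (triple_rows (i, j, k))).
    by rewrite orbT.
  have odds : odd (size (map basis_row s)).
    rewrite size_map -(card_uniqP uniqs) (eq_card sW).
    by have [_ -> _] := hypertree_on_prune HW jL kL; rewrite /= odd_double.
  rewrite detE // -(rows_det_rot _ m odds) -map_rot eqs -catA /triple_rows /=.
  have iS : basis_row i \in map basis_row (x :: s').
    by apply: map_f; rewrite mem_s sW.
  (* As e_i is a later row, the leaf rows reduce to -e_j and -e_k. The two signs cancel, and the
     pair then moves behind e_x. *)
  rewrite [basis_row i - basis_row j]addrC rows_det_addl; last first.
    by rewrite mem_cat inE iS !orbT.
  rewrite -cat_rcons [basis_row i - basis_row k]addrC rows_det_addl; last first.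
    by rewrite mem_cat iS !orbT.
  rewrite rows_detN cat_rcons rows_detN opprK.
  exact: (@rows_det_catC_even _ _ X [:: basis_row j; basis_row k] [:: basis_row x]).
move=> X r rW.
(* If [r] is [j] or [k], the row e_i - e_r is present, so e_r can be exchanged for e_i. *)
have [rj|rj] := eqVneq r j; last have [rk|rk] := eqVneq r k.
- rewrite -(main X i) // -[basis_row i](subrK (basis_row r)) addrC rows_det_addl rj //.
  by rewrite triples_rows_cat !mem_cat mem_head !orbT.
- rewrite -(main X i) // -[basis_row i](subrK (basis_row r)) addrC rows_det_addl rk //.
  by rewrite triples_rows_cat !mem_cat !inE eqxx !orbT.
by apply: main; rewrite !inE rj rk.
Qed.

Lemma hypertree_on_det L W : hypertree_on L W -> has_cyclic_form_det L W.
Proof.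
have [m] := ubnP (size L); elim: m L W => // m IH L W ltm HW.
have [L0|Ln0] := eqVneq L [::].
  move: HW; rewrite {}L0 => -[_ /eqP/cards1P[x ->] _]; exists [:: x]; split=> //.
  - by move=> v; rewrite !inE.
  - by rewrite /= /triples_perm big_nil perm1 eqxx.
  - by move=> X r; rewrite inE => /eqP->.
have [t tL leaf] := exists_leaf HW Ln0.
case/splitPr: {L} tL ltm HW {Ln0} leaf => L1 L2; rewrite size_cat /= => ltm HW.
have ltm' : (size (L1 ++ L2) < m)%N by move: ltm; rewrite addnS size_cat.
have uniqt : uniq (triple_seq t).
  by case: HW => wf _ _; have [|] := wf t; rewrite // mem_cat mem_head orbT.
(* Here [u] is the rotation of [t] that puts its two degree-1 vertices last. *)
have step u : degree (L1 ++ t :: L2) =1 degree (L1 ++ u :: L2) ->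
    hypertree_on (L1 ++ u :: L2) W ->
    degree (L1 ++ t :: L2) u.1.2 = 1%N -> degree (L1 ++ t :: L2) u.2 = 1%N ->
    has_cyclic_form_det (L1 ++ u :: L2) W.
  case: u => -[i j] k degE Hu /=; rewrite !degE.
  have jt : j \in triple_seq (i, j, k) by rewrite !inE eqxx orbT.
  have kt : k \in triple_seq (i, j, k) by rewrite !inE eqxx !orbT.
  move=> /(degree1_split jt) jL /(degree1_split kt) kL.
  by apply: has_cyclic_form_det_leaf => //; apply: IH => //; apply: hypertree_on_prune Hu jL kL.
have degR u v : degree (L1 ++ triple_rot u :: L2) v = degree (L1 ++ u :: L2) v.
  by rewrite /degree !count_cat /= mem_triple_rot.
have uniqR u : uniq (triple_seq u) -> uniq (triple_seq (triple_rot u)).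
  by rewrite -(rot_uniq 1).
have HR := hypertree_on_rot HW.
case/or3P=> /andP[/eqP deg1 /eqP deg2]; first exact: step.
- by apply: has_cyclic_form_det_rot => //; apply: step => // v; rewrite degR.
- apply: has_cyclic_form_det_rot => //; apply: has_cyclic_form_det_rot; first exact: uniqR.
  by apply: step => // [v|]; [rewrite !degR | apply: hypertree_on_rot].
Qed.

(** * Signs of cyclic notations *)

Lemma rows_det_perm (s : 'S_N) :
  rows_det [seq basis_row (s i) | i <- enum 'I_N] = (-1) ^+ odd_perm s.
Proof.
rewrite /rows_det size_map size_enum_ord eqxx -det_perm; congr (\det _).
apply/row_matrixP => i; rewrite rowK (nth_map i) ?size_enum_ord //.
by rewrite nth_ord_enum; apply/rowP => j; rewrite !mxE eqxx /= eq_sym.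
Qed.

(** Each entry is the image under [c] of the one before it. As [N] is a variable, the index 0 is
    passed as an [x] of value 0. *)
Lemma cyclic_form_traject (c s : 'S_N) (x : 'I_N) : is_cyclic_form c s -> x = 0 :> nat ->
  [seq s i | i <- enum 'I_N] = traject c (s x) N.
Proof.
move=> /forallP cyc x0.
apply: (@eq_from_nth _ (s x)) => [|i]; rewrite size_map size_enum_ord ?size_traject //.
move=> iN; rewrite nth_traject // (nth_map x) ?size_enum_ord //.
elim: i iN => [|i IH] iN; first by congr (s _); apply: val_inj; rewrite /= nth_enum_ord.
rewrite /= -IH ?(ltnW iN) // (eqP (cyc _)); congr (s _); apply: val_inj.
by rewrite /= !nth_enum_ord ?(ltnW iN) // modn_small.
Qed.

Lemma fcycle_traject (T : eqType) (f : T -> T) x s :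
  fcycle f (x :: s) -> x :: s = traject f x (size s).+1 /\ iter (size s).+1 f x = x.
Proof.
case/fpathP=> m eqs; have := congr1 size eqs.
rewrite size_rcons size_traject => szE; move: eqs; rewrite -{}szE trajectSr -iterSr.
by case/rcons_inj=> eqs eqx; split; rewrite // [LHS]/= {1}eqs.
Qed.

(** All notations of the cyclic permutation are rotations of one list, and [N] is odd, so the sign
    read in [K] is the same for each of them. *)
Lemma rows_det_hypertree L (r : 'I_N) : hypertree_on L [set: 'I_N] ->
  (exists s, is_cyclic_form (triples_perm L) s) /\
  forall s, is_cyclic_form (triples_perm L) s ->
    rows_det (basis_row r :: triples_rows L) = (-1) ^+ odd_perm s.
Proof.
move=> HL; have [s [uniqs sT cyc detE]] := hypertree_on_det HL.
have szs : size s = N.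
  by rewrite -(card_uniqP uniqs) (eq_card sT) cardsT card_ord.
have oddN : odd N.
  case: HL => _ + _; rewrite cardsT card_ord => /(congr1 odd) ->.
  by rewrite /= odd_double.
split.
  case: s uniqs cyc szs {sT detE} => [|x s] uniqs cyc szs; first by rewrite -szs in oddN.
  have [eqs iterx] := fcycle_traject cyc.
  rewrite -[(size s).+1]/(size (x :: s)) szs in eqs iterx.
  (* The iterates of [x] are the entries of the duplicate-free list; they form the required
     notation. *)
  have inj : injective (fun i : 'I_N => iter i (triples_perm L) x).
    have iterE (i : 'I_N) : iter i (triples_perm L) x = nth x (x :: s) i.
      by rewrite eqs nth_traject.
    by move=> i j /eqP; rewrite !iterE nth_uniq ?szs // => /eqP/val_inj.
  exists (perm inj); apply/forallP => i; rewrite !permE /= -iterS.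
  have [->|ne] := eqVneq i.+1 N; first by rewrite modnn iterx.
  by rewrite modn_small // ltn_neqAle ne ltn_ord.
move=> s' cyc'; rewrite (detE [::] r (in_setT r)) cat0s -rows_det_perm.
have [x x0] : exists x : 'I_N, x = 0 :> nat.
  have := leq_ltn_trans (leq0n _) (ltn_ord r).
  by case: (N) => // m _; exists ord0.
(* Once [s] is rotated to start at the first entry of [s'], both lists are the same orbit. *)
have [|m s2 eqs] := @rot_to _ s (s' x); first by rewrite sT inE.
have /= <- := @rows_det_rot K N [::] (map basis_row s) m; rewrite ?size_map ?szs // -map_rot.
rewrite (map_comp basis_row s') (cyclic_form_traject cyc' x0) eqs.
have : fcycle (triples_perm L) (s' x :: s2) by rewrite -eqs rot_cycle.
case/fcycle_traject => -> _; congr (rows_det (map _ (traject _ _ _))).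
by rewrite -[RHS]szs -(size_rot m s) eqs.
Qed.

End HypertreeDeterminant.

(** * Walks, cycles and circulations *)

Section Walks.
Variable V : finType.
Implicit Types (F B : {set {set V}}) (u v s t : V) (p : seq ({set V} * V)).

Lemma hwalk_cat F u p1 p2 :
  hwalk F u (p1 ++ p2) = hwalk F u p1 && hwalk F (last u (unzip2 p1)) p2.
Proof. by elim: p1 u => [|[e v] p1 IH] u //=; rewrite IH !andbA. Qed.

Lemma hwalk_edges F u p : hwalk F u p -> {subset unzip1 p <= F}.
Proof.
elim: p u => [|[e v] p IH] u //= /and3P[eF _ wp] g.
by rewrite inE => /predU1P[->//|]; apply: IH wp g.
Qed.

Lemma hwalk_const (T : Type) F (f : V -> T) u p :
  {in F, forall e : {set V}, {in e &, forall x y, f x = f y}} ->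
  hwalk F u p -> f u = f (last u (unzip2 p)).
Proof.
move=> fF; elim: p u => [|[e v] p IH] u //= /and3P[eF /subsetP sub wp].
by rewrite -(IH _ wp); apply: (fF e eF); apply: sub; rewrite !inE eqxx ?orbT.
Qed.

Lemma connected_const (T : Type) F (f : V -> T) :
  {in F, forall e : {set V}, {in e &, forall x y, f x = f y}} ->
  hconnected F -> cover F = [set: V] -> forall u v, f u = f v.
Proof.
move=> fF conn cov u v; have [||p [wp <- _ _]] := conn u v; rewrite ?cov ?inE //.
exact: hwalk_const fF wp.
Qed.

(** If [w] is on the path, its tail from [w] is taken. If [e] is used, [w] enters the path at the
    vertex after [e]. Otherwise the step through [e] is prepended. *)
Lemma hpath_extend F e u w t p : e \in F -> u \in e -> w \in e ->
  hpath F u t p -> exists p', hpath F w t p'.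
Proof.
move=> eF ue we [wp lp up ep].
have [->|wu] := eqVneq w u; first by exists p.
have [wp2|wp2] := boolP (w \in unzip2 p).
  have /mapP[[f x] fp /= eqx] := wp2; rewrite -{x}eqx in fp.
  case/splitPr: fp wp lp up ep {wp2} => p1 p2; rewrite hwalk_cat /= => /and4P[_ _ _ wp].
  rewrite /unzip2 /unzip1 !map_cat last_cat /= => lp /andP[_].
  by rewrite !cat_uniq /= => /and3P[_ _ up] /and4P[_ _ _ ep]; exists p2.
have [ep1|ep1] := boolP (e \in unzip1 p).
  have /mapP[[f x] fp /= eqf] := ep1; rewrite -{f}eqf in fp.
  case/splitPr: fp wp lp up ep wp2 {ep1} => p1 p2; rewrite hwalk_cat /= => /and4P[_ _ sub wp].
  rewrite /unzip2 /unzip1 !map_cat last_cat /= => lp /andP[_].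
  rewrite !cat_uniq /= => /and3P[_ _ up] /and3P[_ _ ep].
  rewrite mem_cat inE => /norP[_ /norP[wx wp2]].
  exists ((e, x) :: p2); split=> //=; rewrite ?inE ?negb_or ?wx ?wp2 //.
  by rewrite eF wp; move: sub; rewrite !subUset !sub1set we => /andP[_ ->].
exists ((e, u) :: p); split=> //=; last by rewrite ep1.
  by rewrite eF wp subUset !sub1set we ue.
by move: up => /= ->; rewrite inE negb_or wu wp2.
Qed.

(** Makes reachability Boolean through [connect], so that components have indicator functions. *)
Definition hadj F : rel V := fun u v => [exists e in F, (u \in e) && (v \in e)].

Lemma connect_hpath F s t : connect (hadj F) s t -> exists p, hpath F s t p.
Proof.
case/connectP=> q; elim: q s => [|v q IH] s /=; first by move=> _ ->; exists [::].
case/andP=> /exists_inP[e eF /andP[se ve]] /IH{}IH /IH[p hp].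
exact: hpath_extend eF ve se hp.
Qed.

Lemma connect_hadj_edge F e u v t : e \in F -> u \in e -> v \in e ->
  connect (hadj F) u t = connect (hadj F) v t.
Proof.
move=> eF ue ve.
by apply/idP/idP; apply: connect_trans; apply: connect1; apply/exists_inP;
  exists e; rewrite ?ue ?ve.
Qed.

Section Weights.
Variable K : fieldType.
Implicit Type w : {set V} -> V -> K.

(** A linear dependency between columns, recorded by what the line of [e] contributes to row [v]
    instead of by its coefficients. *)
Definition circulation B w : Prop :=
  [/\ {in B, forall e : {set V}, forall v, w e v != 0 -> v \in e},
      {in B, forall e : {set V}, \sum_v w e v = 0}
    & forall v, \sum_(e in B) w e v = 0].

Lemma sum0_other (I : finType) (P : pred I) (f : I -> K) i :
  P i -> \sum_(j | P j) f j = 0 -> f i != 0 ->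
  exists2 j, P j & (j != i) && (f j != 0).
Proof.
move=> Pi sum0 fi; apply/exists_inP; apply: contraTT fi => /exists_inPn none.
rewrite negbK; move: sum0; rewrite (bigD1 i) //= big1 ?addr0 => [->//|j /andP[Pj ji]].
by have := none j Pj; rewrite ji negbK => /eqP.
Qed.

Lemma circulation_cycle B w e0 v0 : circulation B w ->
  e0 \in B -> w e0 v0 != 0 -> exists s p, hcycle B s p.
Proof.
move=> [supp row0 col0] e0B we0.
(* A walk through nonzero weights can be prolonged at its start until it
   meets itself, as no vertex or hyperedge carries a single nonzero weight. *)
suff ext m u e v p : (#|B| - size p < m)%N -> hwalk B u ((e, v) :: p) ->
    uniq (u :: v :: unzip2 p) -> uniq (e :: unzip1 p) -> w e u != 0 ->
    exists s p, hcycle B s p.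
  have [u _ /andP[uv wu]] := sum0_other isT (row0 _ e0B) we0.
  apply: (ext #|B|.+1 u e0 v0 [::]); rewrite ?subn0 //= ?inE ?uv //.
  by rewrite e0B subUset !sub1set !supp.
elim: m u e v p => // m IH u e v p ltm wP uP eP weu.
have eB : e \in B by case/andP: wP.
have [f fB /andP[fe wfu]] := sum0_other eB (col0 u) weu.
have {}fB : f \in B by [].
have uf := supp f fB u wfu.
set P := (e, v) :: p in wP *.
(* A hyperedge [f] already used contains [u], so the walk is cut at [f] and led back to [u]. *)
have [fP|fP] := boolP (f \in unzip1 P).
  move: fP; rewrite inE (negPf fe) /= => /mapP[[f' x] fp /= eqf].
  rewrite -{f'}eqf in fp.
  rewrite /P in wP; case/splitPr: fp wP uP eP {IH ltm} => p1 p2.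
  rewrite /= hwalk_cat /= => /and3P[_ sub /and4P[wp1 _ sub2 _]].
  rewrite /unzip1 /unzip2 !map_cat /= => /and3P[]; rewrite inE => /norP[uv].
  rewrite mem_cat => /norP[up1 _]; rewrite mem_cat => /norP[vp1 _].
  rewrite cat_uniq => /andP[up _].
  rewrite -cat_rcons mem_cat => /andP[/norP[ef _]]; rewrite cat_uniq => /andP[ep _].
  exists u, ((e, v) :: rcons p1 (f, u)); split.
  - rewrite /= eB sub -cats1 hwalk_cat wp1 /= fB andbT /= subUset !sub1set uf andbT.
    by move: sub2; rewrite subUset !sub1set => /andP[].
  - by rewrite /= /unzip2 map_rcons last_rcons.
  - by rewrite /= size_rcons.
  - by rewrite /= /unzip2 map_rcons rcons_uniq mem_rcons inE eq_sym (negPf uv) vp1 up1 up.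
  by rewrite /= /unzip1 map_rcons ef ep.
have [x _ /andP[xu wfx]] := sum0_other isT (row0 _ fB) wfu.
have xf := supp f fB x wfx.
(* If [x] was visited, the part of the walk from [u] to [x] is closed through [f]. *)
have [xP|xP] := boolP (x \in unzip2 P).
  have /mapP[[g x'] gp /= eqx] := xP; rewrite -{x'}eqx in gp.
  have {}uP : uniq (u :: unzip2 P) by [].
  have {}eP : uniq (f :: unzip1 P) by rewrite /= fP.
  case/splitPr: gp wP uP eP {IH ltm xP fP} => p1 p2.
  rewrite hwalk_cat /= => /and4P[wp1 gB sub2 _].
  rewrite /unzip1 /unzip2 !map_cat !map_cons -!cat_rcons.
  rewrite !mem_cat !negb_or !cat_uniq.
  move=> /andP[/andP[up1 _] /andP[up _]] /andP[/andP[fp1 _] /andP[ep _]].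
  exists x, ((f, u) :: rcons p1 (g, x)); split.
  - by rewrite /= fB subUset !sub1set xf uf -cats1 hwalk_cat wp1 /= gB sub2.
  - by rewrite /= /unzip2 map_rcons last_rcons.
  - by rewrite /= size_rcons.
  - by rewrite /= /unzip2 map_rcons up1 up.
  by rewrite /= /unzip1 map_rcons fp1 ep.
(* The hyperedges of the walk and [f] are distinct members of [B], so the measure decreases. *)
have szB : (size P < #|B|)%N.
  have sub g : g \in f :: unzip1 P -> g \in enum B.
    by rewrite inE mem_enum => /predU1P[->//|]; apply: hwalk_edges wP _.
  have uniqf : uniq (f :: unzip1 P) by rewrite /= fP.
  by have := uniq_leq_size uniqf sub; rewrite -cardE /= size_map.
apply: (IH x f u P) => //.
- by rewrite -ltnS (leq_trans _ ltm) // ltnS ltn_sub2l // ltnW.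
- by rewrite /= fB subUset !sub1set xf uf /=.
- by move: xP uP; rewrite /P /= !inE !negb_or => /andP[-> ->]; rewrite xu.
- by rewrite /= fP.
Qed.

(** Each step from u to x through f adds 1 at (f, u) and -1 at (f, x). At every vertex the sum
    telescopes to start minus end, which vanishes for a closed walk. *)
Fixpoint walk_weight u p (e : {set V}) v : K :=
  if p is (f, x) :: p' then
    (e == f)%:R * ((v == u)%:R - (v == x)%:R) + walk_weight x p' e v
  else 0.

Lemma sum_indicator (x : V) : \sum_v (v == x)%:R = 1 :> K.
Proof. by rewrite (bigD1 x) //= eqxx big1 ?addr0 // => v /negPf->. Qed.

Lemma cycle_circulation B s p : hcycle B s p ->
  exists w, circulation B w /\ exists e v, e \in B /\ w e v != 0.
Proof.
move=> [wp lp szp up ep]; exists (walk_weight s p); split; [split|].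
- move=> e _ v; elim: p s wp {lp szp up ep} => [|[f x] p IH] s /=; first by rewrite eqxx.
  case/and3P=> fB; rewrite subUset !sub1set => /andP[sf xf] wp.
  have [ef|_] := eqVneq e f; last by rewrite mul0r add0r; apply: IH.
  have [->|_] := eqVneq v s; first by rewrite ef.
  have [->|_] := eqVneq v x; first by rewrite ef.
  by rewrite subrr mulr0 add0r; apply: IH.
- move=> e _; elim: p s {wp lp szp up ep} => [|[f x] p IH] s /=; first by rewrite big1.
  by rewrite big_split /= IH addr0 -big_distrr /= sumrB !sum_indicator subrr mulr0.
- move=> v; have -> : \sum_(e in B) walk_weight s p e v =
    (v == s)%:R - (v == last s (unzip2 p))%:R.
    elim: p s wp {lp szp up ep} => [|[f x] p IH] s /=; first by rewrite big1 ?subrr.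
    case/and3P=> fB _ wp; rewrite big_split /= IH // (bigD1 f) //= eqxx mul1r big1.
      by rewrite addr0 addrA subrK.
    by move=> e /andP[_ /negPf->]; rewrite mul0r.
  by rewrite lp subrr.
case: p wp lp szp up ep => [|[f x] [|[g y] p]] //= /andP[fB _] lp _ + /andP[fp _].
(* Only the first step uses [f]; it gives [s] the weight 1, since the next vertex differs from
   [s]. *)
have fw q u : f \notin unzip1 q -> walk_weight u q f s = 0.
  elim: q u => [|[h z] q IH] u //=; rewrite inE negb_or => /andP[/negPf-> fq].
  by rewrite mul0r add0r IH.
rewrite inE negb_or => /andP[/andP[xy xp] _]; exists f, s; split=> //.
have /= -> := fw ((g, y) :: p) x fp; rewrite addr0 !eqxx mul1r.
have /negPf-> : s != x; last by rewrite subr0 oner_neq0.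
apply: contraTneq (mem_last y (unzip2 p)) => sx.
by rewrite lp sx inE negb_or xy.
Qed.

End Weights.
End Walks.

(** * Lines of the incidence matrix *)

(** Translates column indices into arcs: half the index is the position of the hyperedge, its parity
    selects the arc. *)
Lemma map_halves (T S : Type) (x0 : T) (es : seq T) (P : pred T) (G : T -> bool -> S) :
  [seq G (nth x0 es c./2) (odd c) | c <- iota 0 (size es).*2 & P (nth x0 es c./2)] =
  flatten [seq [:: G e false; G e true] | e <- es & P e].
Proof.
elim: es => [|e es IH] //; set G' := fun c => G (nth x0 (e :: es) c./2) (odd c).
set P' := fun c => P (nth x0 (e :: es) c./2).
have tailE : [seq G' c | c <- iota 2 (size es).*2 & P' c] =
    flatten [seq [:: G e false; G e true] | e <- es & P e].
  rewrite (iotaDl 2 0) filter_map -map_comp -IH /G'.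
  by apply: eq_map => c /=; rewrite negbK.
transitivity ((if P e then [:: G e false; G e true] else [::]) ++
    [seq G' c | c <- iota 2 (size es).*2 & P' c]); last by rewrite tailE /=; case: (P e).
by rewrite /P' /G' /=; case: (P e).
Qed.

Section Lines.
Variables (K : fieldType) (m : nat).
Let N := m.+1.
Variables (o : {set 'I_N} -> 'I_N * 'I_N * 'I_N) (es : seq {set 'I_N}).
Variables (B : {set {set 'I_N}}) (r : 'I_N).
Let cols := line_cols (@hyperedge_line N es) B.
Let lines := [seq e <- es | e \in B].
Let M := col_submx (row' r (incidence K o es)) cols.

Definition arc_end (e : {set 'I_N}) (b : bool) : 'I_N :=
  if b then (o e).2 else (o e).1.2.

Definition arc_row (e : {set 'I_N}) (b : bool) : 'rV[K]_N :=
  basis_row K (o e).1.1 - basis_row K (arc_end e b).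

Lemma arc_rowE e b v :
  arc_row e b 0 v = (v == (o e).1.1)%:R - (v == arc_end e b)%:R.
Proof. by rewrite !mxE eqxx. Qed.

Lemma incidenceE v c :
  incidence K o es v c = arc_row (nth set0 es c./2) (odd c) 0 v.
Proof.
by rewrite arc_rowE mxE /col_arc /arc_end; case: (o _) => -[i j] k.
Qed.

Lemma mem_line_cols c : (c \in cols) = (nth set0 es c./2 \in B).
Proof.
apply/bigcupP/idP => [[e eB]|cB]; first by rewrite inE => /eqP->.
by exists (nth set0 es c./2); rewrite ?inE.
Qed.

Lemma map_line_cols (S : Type) (G : {set 'I_N} -> bool -> S) :
  [seq G (nth set0 es (val c)./2) (odd (val c)) | c <- enum cols] =
  flatten [seq [:: G e false; G e true] | e <- lines].
Proof.
rewrite -(map_halves set0 es (mem B) G) -val_enum_ord filter_map -map_comp.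
by rewrite {1}/enum_mem -enumT; congr map; apply: eq_filter => c; apply: mem_line_cols.
Qed.

Lemma rows_line_cols :
  [seq \row_v incidence K o es v c | c <- enum cols] = triples_rows K (map o lines).
Proof.
rewrite /triples_rows -map_comp -[RHS](map_line_cols arc_row).
by apply: eq_map => c; apply/rowP => v; rewrite mxE incidenceE.
Qed.

Lemma card_line_cols : #|cols| = (size lines).*2.
Proof.
rewrite cardE -(size_map (fun=> tt)) (map_line_cols (fun _ _ => tt)).
by elim: lines => //= e s ->.
Qed.

Lemma det_line_submx (sq : #|cols| = m) :
  rows_det (basis_row K r :: triples_rows K (map o lines)) =
  (-1) ^+ r * \det (line_submx (row' r (incidence K o es)) sq).
Proof.
rewrite -rows_line_cols /rows_det /= size_map -cardE sq eqxx.
(* Expansion along e_r leaves only the cofactor at (0, r), whence the sign; the minor is the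
   transpose of the submatrix. *)
rewrite (expand_det_row _ ord0) (bigD1 r) //= big1 => [|j jr]; last first.
  by rewrite !mxE (negPf jr) andbF mul0r.
rewrite addr0 !mxE !eqxx mul1r /cofactor add0n -det_tr; congr (_ * \det _).
apply/matrixP => i j; rewrite !mxE castmxE !mxE /= cast_ord_id.
have jlt : (j < size (enum cols))%N by rewrite -cardE sq.
have c0 : 'I_(size es).*2 by apply: (enum_val (cast_ord (esym sq) j)).
by rewrite (nth_map c0) // mxE (enum_val_nth c0) add0n mxE.
Qed.

(** * Left and right null vectors of the submatrix *)

Hypotheses (uniq_es : uniq es) (sub_es : {subset B <= es}).

Lemma col_of_arc e b : e \in B -> exists c : 'I_#|cols|,
  nth set0 es (enum_val c)./2 = e /\ odd (enum_val c) = b.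
Proof.
move=> eB; have := sub_es eB; rewrite -index_mem => lt.
have ltc : (b + (index e es).*2 < (size es).*2)%N.
  by rewrite -leq_double in lt; apply: leq_trans lt; rewrite doubleS; case: b.
have cin : Ordinal ltc \in cols.
  by rewrite mem_line_cols /= half_bit_double nth_index // sub_es.
exists (enum_rank_in cin (Ordinal ltc)); rewrite enum_rankK_in //=.
by rewrite half_bit_double nth_index ?sub_es // oddD odd_double addbF oddb.
Qed.

(** With row [r] deleted, left vectors correspond to vertex functions vanishing at [r]. *)
Lemma mulmx_row_const (y : 'I_N -> K) (c : 'I_#|cols|) : y r = 0 ->
  ((\row_j y (lift r j)) *m M) 0 c =
  y (o (nth set0 es (enum_val c)./2)).1.1 -
  y (arc_end (nth set0 es (enum_val c)./2) (odd (enum_val c))).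
Proof.
move=> yr; set e := nth _ _ _; set b := odd _.
transitivity (\sum_v y v * arc_row e b 0 v).
  rewrite mxE (bigD1_ord r) //= yr mul0r add0r; apply: eq_bigr => j _.
  by rewrite /e /b -incidenceE !mxE.
under eq_bigr do rewrite arc_rowE mulrBr.
have pick v : \sum_u y u * (u == v)%:R = y v.
  rewrite (bigD1 v) //= eqxx mulr1 big1 ?addr0 // => u /negPf->.
  by rewrite mulr0.
by rewrite sumrB !pick.
Qed.

Definition const_on_edges (y : 'I_N -> K) :=
  {in B, forall e, forall b, y (o e).1.1 = y (arc_end e b)}.

Lemma row_free_const : row_free M <->
  forall y, y r = 0 -> const_on_edges y -> forall v, y v = 0.
Proof.
split=> [free y yr const v|H].
  have yM0 : (\row_j y (lift r j)) *m M = 0.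
    apply/rowP => c; have := enum_valP c; rewrite mem_line_cols => cB.
    by rewrite mulmx_row_const // (const _ cB (odd (enum_val c))) subrr mxE.
  have y0 := row_free_inj free (etrans yM0 (esym (mul0mx _ M))).
  have [j ->|-> //] := unliftP r v.
  by have /rowP/(_ j) := y0; rewrite !mxE.
apply: inj_row_free => z zM0.
pose y v := if unlift r v is Some j then z 0 j else 0.
have yr : y r = 0 by rewrite /y unlift_none.
have zE : z = \row_j y (lift r j).
  by apply/rowP => j; rewrite mxE /y liftK.
apply/rowP => j; rewrite zE !mxE; apply: H => // e eB b.
have [c [ce cb]] := col_of_arc b eB.
have := mulmx_row_const c yr; rewrite -zE zM0 mxE ce cb => /esym/eqP.
by rewrite subr_eq0 => /eqP.
Qed.

Lemma sum_line_cols (G : {set 'I_N} -> bool -> K) :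
  \sum_(c < #|cols|) G (nth set0 es (enum_val c)./2) (odd (enum_val c)) =
  \sum_(e in B) (G e false + G e true).
Proof.
transitivity (\sum_(x <- flatten [seq [:: G e false; G e true] | e <- lines]) x).
  by rewrite -map_line_cols big_map big_enum [RHS]big_enum_val.
rewrite big_flatten big_map /=; transitivity (\sum_(e <- lines) (G e false + G e true)).
  by apply: eq_bigr => e _; rewrite !big_cons big_nil addr0.
rewrite -[RHS]big_enum; apply: perm_big; apply: uniq_perm.
- exact: filter_uniq.
- exact: enum_uniq.
by move=> e; rewrite mem_filter mem_enum andb_idr //; apply: sub_es.
Qed.

(** What the line of [e] contributes to row [v] under the coefficients [X]: the weights of a
    circulation when [X] is a dependency. *)
Definition arc_weight (X : {set 'I_N} -> bool -> K) e v : K :=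
  X e false * arc_row e false 0 v + X e true * arc_row e true 0 v.

Lemma sum_arc_weight X e : \sum_v arc_weight X e v = 0.
Proof.
have arc0 b : \sum_v arc_row e b 0 v = 0.
  under eq_bigr do rewrite arc_rowE.
  by rewrite sumrB !sum_indicator subrr.
by rewrite big_split /= -!big_distrr /= !arc0 !mulr0 addr0.
Qed.

Lemma mulmx_tr_weight (X : {set 'I_N} -> bool -> K) i :
  ((\row_(c < #|cols|) X (nth set0 es (enum_val c)./2) (odd (enum_val c))) *m M^T) 0 i =
  \sum_(e in B) arc_weight X e (lift r i).
Proof.
rewrite mxE -(sum_line_cols (fun e b => X e b * arc_row e b 0 (lift r i))).
by apply: eq_bigr => c _; rewrite -incidenceE !mxE.
Qed.

Lemma row_free_tr_weight : row_free M^T <->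
  forall X, (forall v, \sum_(e in B) arc_weight X e v = 0) ->
    {in B, forall e, forall b, X e b = 0}.
Proof.
split=> [free X X0 e eB b|H].
  set x := \row_(c < #|cols|) X (nth set0 es (enum_val c)./2) (odd (enum_val c)).
  have xM0 : x *m M^T = 0 by apply/rowP => i; rewrite mulmx_tr_weight X0 mxE.
  have x0 := row_free_inj free (etrans xM0 (esym (mul0mx _ M^T))).
  have [c [ce cb]] := col_of_arc b eB.
  by have /rowP/(_ c) := x0; rewrite !mxE ce cb.
apply: inj_row_free => x xM0.
(* For [e] in [B] exactly one column matches, as [es] has no repetition. *)
pose X e b := \sum_(c < #|cols| | (nth set0 es (enum_val c)./2 == e) &&
                        (odd (enum_val c) == b)) x 0 c.
have xE : x = \row_(c < #|cols|) X (nth set0 es (enum_val c)./2) (odd (enum_val c)).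
  apply/rowP => c; rewrite mxE /X (big_pred1 c) // => d /=.
  apply/andP/eqP => [[/eqP ed /eqP od]|->//].
  apply: enum_val_inj; apply: val_inj.
  rewrite -[LHS]odd_double_half -[RHS]odd_double_half od; congr (_ + _.*2)%N.
  by apply/eqP; rewrite -(nth_uniq set0 _ _ uniq_es) ?ed // ltn_half_double ltn_ord.
have X0 i : \sum_(e in B) arc_weight X e (lift r i) = 0.
  by rewrite -mulmx_tr_weight -xE xM0 mxE.
(* The equation of the deleted row follows from the others, because every column of the full matrix
   sums to 0. *)
have Xr : \sum_(e in B) arc_weight X e r = 0.
  have : \sum_v \sum_(e in B) arc_weight X e v = 0.
    by rewrite exchange_big big1 // => e _; rewrite sum_arc_weight.
  by rewrite (bigD1_ord r) //= [X in _ + X]big1 ?addr0.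
apply/rowP => c; rewrite xE !mxE; apply: H.
  by move=> v; have [j ->|->] := unliftP r v.
by rewrite -mem_line_cols enum_valP.
Qed.

Hypothesis (edges : {in B, forall e, e = [set (o e).1.1; (o e).1.2; (o e).2]}).
Hypothesis (edges3 : {in B, forall e : {set 'I_N}, #|e| = 3%N}).

Lemma edge_uniq e : e \in B -> uniq (triple_seq (o e)).
Proof.
move=> eB; have := edges3 eB; rewrite {1}(edges eB) => card3.
apply/card_uniqP; rewrite -[RHS]/3%N -card3; apply: eq_card => v.
by rewrite !inE orbA.
Qed.

Lemma edge_mem e v : e \in B -> (v \in e) = (v \in triple_seq (o e)).
Proof. by move=> eB; rewrite {1}(edges eB) !inE orbA. Qed.

Lemma row_free_connected : (0 < m)%N ->
  row_free M <-> hconnected B /\ cover B = [set: 'I_N].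
Proof.
move=> m_gt0; have endin e b : e \in B -> (o e).1.1 \in e /\ arc_end e b \in e.
  by move=> eB; rewrite /arc_end !edge_mem // !inE !eqxx;
  case: b; rewrite !eqxx ?orbT.
rewrite row_free_const; split=> [H|[conn cov] y yr const v].
  split.
    move=> s t _ _; apply: connect_hpath.
    (* The indicator of the component of [t], shifted to vanish at [r]. *)
    pose y u : K := (connect (hadj B) u t)%:R - (connect (hadj B) r t)%:R.
    have y0 : forall v, y v = 0.
      apply: H => [|e eB b]; first by rewrite /y subrr.
      by have [ie ae] := endin e b eB; rewrite /y (connect_hadj_edge t eB ie ae).
    have := y0 s; rewrite -(y0 t) /y => /addIr; rewrite connect0.
    by case: connect => // /eqP; rewrite eq_sym oner_eq0.
  apply/setP => v; rewrite inE; apply: contraT => vB.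
  pose y u : K := (u == v)%:R - (r == v)%:R.
  have y0 : forall u, y u = 0.
    apply: H => [|e eB b]; first by rewrite /y subrr.
    have [ie ae] := endin e b eB; have ve : v \notin e.
      by apply: contra vB => ve; apply/bigcupP; exists e.
    have ne u : u \in e -> (u == v) = false by move=> ue; apply: contraNF ve => /eqP<-.
    by rewrite /y (ne _ ie) (ne _ ae).
  (* A second vertex shows that the indicator of [v] is not constant. With one vertex and [B] empty
     the matrix is 0 by 0, hence row free, although nothing is covered. *)
  have [u uv] : exists u : 'I_N, u != v.
    exists (lift v (Ordinal m_gt0)); by rewrite eq_sym neq_lift.
  have := y0 v; rewrite -(y0 u) /y => /addIr; rewrite eqxx (negPf uv) => /eqP.
  by rewrite oner_eq0.
rewrite -yr; apply: connected_const conn cov v r => e eB.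
have ye x : x \in e -> y x = y (o e).1.1.
  rewrite edge_mem // !inE => /or3P[]/eqP-> //; first by rewrite (const e eB false).
  by rewrite (const e eB true).
by move=> u x ue xe; rewrite !ye.
Qed.

Lemma edge_neq e : e \in B ->
  [/\ ((o e).1.2 == (o e).1.1) = false, ((o e).2 == (o e).1.1) = false
    & ((o e).2 == (o e).1.2) = false].
Proof.
move=> /edge_uniq; rewrite /= !inE negb_or -!(eq_sym (o e).2) (eq_sym (o e).1.1).
by move=> /and3P[/andP[/negPf-> /negPf->] /negPf->].
Qed.

Lemma arc_weight_end X e b : e \in B -> arc_weight X e (arc_end e b) = - X e b.
Proof.
move=> /edge_neq[ji ki kj]; rewrite /arc_weight !arc_rowE /arc_end.
by case: b; rewrite !eqxx ?ki ?ji ?(eq_sym (o e).1.2 (o e).2) ?kj /=; ring.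
Qed.

Lemma row_free_acyclic : row_free M^T <-> ~ (exists s p, hcycle B s p).
Proof.
rewrite row_free_tr_weight; split=> [H [s [p cyc]]|acyc X X0 e eB b].
  have [w [[supp row0 col0] [e [v [eB /negP]]]]] := cycle_circulation K cyc; apply.
  (* At the end of an arc its column is -1 and the other column of the line is 0, which determines
     the coefficient. At the common tail the weights agree because they sum to 0 over the
     hyperedge. *)
  pose X e b := - w e (arc_end e b).
  have wX f u : f \in B -> w f u = arc_weight X f u.
    move=> fB; have uniqf := edge_uniq fB; have [ji ki kj] := edge_neq fB.
    have [uf|uf] := boolP (u \in triple_seq (o f)); last first.
      have -> : w f u = 0.
        by apply: contraNeq uf => /(supp f fB u); rewrite edge_mem.
      move: uf; rewrite !inE !negb_or /arc_weight !arc_rowE /arc_end.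
      by move=> /and3P[/negPf-> /negPf-> /negPf->]; rewrite subrr !mulr0 addr0.
    have [ui|ui] := eqVneq u (o f).1.1; last first.
      suff [b ->] : exists b, u = arc_end f b by rewrite arc_weight_end // opprK.
      move: uf; rewrite !inE (negPf ui) /= => /orP[]/eqP->; by [exists false | exists true].
    have : w f (o f).1.1 + (w f (o f).1.2 + w f (o f).2) = 0.
      rewrite -[RHS](row0 f fB) (bigID (mem (triple_seq (o f)))) /=.
      rewrite [X in _ = _ + X]big1.
        by rewrite addr0 -big_uniq //= !big_cons big_nil addr0.
      by move=> z; apply: contraNeq => /(supp f fB z); rewrite edge_mem.
    rewrite ui /arc_weight !arc_rowE /arc_end !eqxx /X /arc_end => /eqP.
    rewrite addr_eq0 !(eq_sym (o f).1.1) ji ki /= => /eqP->; ring.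
  have X0 : {in B, forall e, forall b, X e b = 0}.
    by apply: H => u; rewrite -[RHS](col0 u); apply: eq_bigr => f fB; rewrite wX.
  by rewrite wX // /arc_weight !X0 // !mul0r addr0.
apply/eqP; rewrite -oppr_eq0 -arc_weight_end //; apply: contraT => nz; case: acyc.
apply: (circulation_cycle _ eB nz); split=> //.
- move=> f fB v; rewrite edge_mem // !inE; apply: contraNT => /norP[vi /norP[vj vk]].
  rewrite /arc_weight !arc_rowE /arc_end (negPf vi) (negPf vj) (negPf vk).
  by rewrite subrr !mulr0 addr0.
- by move=> f _; apply: sum_arc_weight.
Qed.

End Lines.

(** * Parity bases *)

(** Reconciles the column order given by [es] with the ordering of the product picked in
    [hypertree_sgn]. *)
Lemma rows_det_perm_eq (K : fieldType) N (L1 L2 : seq ('I_N * 'I_N * 'I_N)) X :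
  perm_eq L1 L2 ->
  rows_det (X ++ triples_rows K L1) = rows_det (X ++ triples_rows K L2).
Proof.
elim: L1 L2 X => [|t L1 IH] L2 X; first by rewrite perm_sym => /perm_nilP->.
move=> eqL; have tL : t \in L2 by rewrite -(perm_mem eqL) mem_head.
case/splitPr: tL eqL => L3 L4;
rewrite perm_sym (perm_catCA _ [:: t]) perm_cons perm_sym => eqL.
have consE L : triples_rows K (t :: L) = triple_rows K t ++ triples_rows K L by [].
rewrite consE catA (IH _ _ eqL) !triples_rows_cat consE -catA.
exact: (@rows_det_catC_even _ _ X (triple_rows K t)).
Qed.

Lemma unitmx_castmx (K : fieldType) p q (eqq : q = p) (M : 'M[K]_(p, q)) :
  castmx (erefl p, eqq) M \in unitmx -> row_free M && row_free M^T.
Proof.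
by case: p / eqq M => M; rewrite castmx_id !row_free_unit unitmx_tr => ->.
Qed.

Lemma castmx_unitmx (K : fieldType) p q (eqq : q = p) (M : 'M[K]_(p, q)) :
  row_free M -> castmx (erefl p, eqq) M \in unitmx.
Proof. by case: p / eqq M => M; rewrite castmx_id row_free_unit. Qed.

Section ParityBases.
Variables (K : fieldType) (n : nat) (n_gt0 : (0 < n)%N).
Let N := n.*2.+1.
Variables (E : {set {set 'I_N}}) (E3 : uniform3 E).
Variables (o : {set 'I_N} -> 'I_N * 'I_N * 'I_N) (o_orient : is_orientation E o).
Variables (es : seq {set 'I_N}) (es_enum : perm_eq es (enum E)) (r : 'I_N).
Let A := row' r (incidence K o es).

(** Free rows and free columns together force the submatrix to be square, so the condition becomes
    Boolean and free of casts. *)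
Lemma parity_baseP B : parity_base A (@hyperedge_line N es) E B <->
  B \subset E /\ let M := col_submx A (line_cols (@hyperedge_line N es) B) in
                 row_free M && row_free M^T.
Proof.
rewrite /parity_base /line_submx; split=> [[sBE [sq unitM]]|[sBE /= /andP[free freeT]]].
  by split=> //; apply: unitmx_castmx unitM.
have sq : #|line_cols (@hyperedge_line N es) B| = N.-1.
  by move: free freeT; rewrite /row_free mxrank_tr => /eqP-> /eqP.
by split=> //; exists sq; apply: castmx_unitmx.
Qed.

Let uniq_es : uniq es.
Proof. by rewrite (perm_uniq es_enum) enum_uniq. Qed.

Let mem_es e : (e \in es) = (e \in E).
Proof. by rewrite (perm_mem es_enum) mem_enum. Qed.

Section Base.
Variables (B : {set {set 'I_N}}) (sBE : B \subset E).

Let sub_es : {subset B <= es}.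
Proof. by move=> e eB; rewrite mem_es (subsetP sBE). Qed.

Let edges : {in B, forall e, e = [set (o e).1.1; (o e).1.2; (o e).2]}.
Proof. by move=> e eB; apply: o_orient; apply: (subsetP sBE). Qed.

Let edges3 : {in B, forall e : {set 'I_N}, #|e| = 3%N}.
Proof. by move=> e eB; apply: E3; apply: (subsetP sBE). Qed.

Lemma parity_base_hypertree :
  parity_base A (@hyperedge_line N es) E B <-> spanning_hypertree E B.
Proof.
have dn : (0 < n.*2)%N by rewrite double_gt0.
rewrite parity_baseP /=; split.
  case=> _ /andP[/(row_free_connected K r sub_es edges dn)[conn cov]].
  by move=> /(row_free_acyclic K r uniq_es sub_es edges edges3) acyc.
case=> _ [conn acyc] cov; split=> //; apply/andP; split.
  by apply/(row_free_connected K r sub_es edges dn).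
by apply/(row_free_acyclic K r uniq_es sub_es edges edges3).
Qed.

Lemma det_base (sq : #|line_cols (@hyperedge_line N es) B| = n.*2) :
  spanning_hypertree E B ->
  \det (line_submx A sq) = (-1) ^+ r * (hypertree_sgn o B)%:~R.
Proof.
case=> _ [conn acyc] cov.
have perm_lines : perm_eq [seq e <- es | e \in B] (enum B).
  apply: uniq_perm; [exact: filter_uniq | exact: enum_uniq | move=> e].
  by rewrite mem_filter mem_enum andb_idr //; apply: sub_es.
have tree L : perm_eq L (enum B) -> hypertree_on (map o L) [set: 'I_N].
  move=> eqL; have memL e : e \in L -> e \in B by rewrite (perm_mem eqL) mem_enum.
  split.
  - move=> _ /mapP[e /memL eB ->]; split; last by move=> v _; rewrite inE.
    exact: (edge_uniq edges edges3 eB).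
  (* The vertex count of a hypertree is read off from the squareness of the submatrix. *)
  - rewrite cardsT card_ord size_map (perm_size eqL) -(perm_size perm_lines).
    by rewrite -card_line_cols sq.
  move=> f fL u v _ _; apply: connected_const conn cov u v => e eB.
  have [] := fL (o e); first by rewrite map_f // (perm_mem eqL) mem_enum.
  move=> fij fik; have fe x : x \in e -> f x = f (o e).1.1.
    by rewrite (edge_mem edges) // !inE => /or3P[]/eqP->.
  by move=> x y xe ye; rewrite !fe.
have prodE L : (\prod_(e <- L) sigma o e)%g = triples_perm (map o L).
  by rewrite /triples_perm big_map.
have -> : \det (line_submx A sq) = (-1) ^+ r *
    rows_det (basis_row K r :: triples_rows K [seq o e | e <- es & e \in B]).
  by rewrite (det_line_submx _ o r sq) mulrA -expr2 sqrr_sign mul1r.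
congr (_ * _); rewrite /hypertree_sgn; case: pickP => [[x s] /= /andP[permx cyc]|none].
  rewrite (@rows_det_perm_eq _ _ _ (map o x) [:: _]); last first.
    by apply: perm_map; rewrite (perm_trans perm_lines) // perm_sym.
  have [_ detE] := rows_det_hypertree K r (tree _ permx).
  by rewrite [LHS](detE s) -?prodE // rmorphXn rmorphN1.
(* The dummy value is never reached: the product in the order of [enum B] has a cyclic notation. *)
have [[s cyc] _] := rows_det_hypertree K r (tree _ (perm_refl _)).
have sz : size (enum B) == #|B| by rewrite -cardE.
by have := none (Tuple sz, s); rewrite /= perm_refl prodE cyc.
Qed.

End Base.

End ParityBases.

Theorem theorem3p14 (K : fieldType) (n : nat) (n_gt0 : (0 < n)%N)
    (E : {set {set 'I_n.*2.+1}}) (E3 : uniform3 E)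
    (o : {set 'I_n.*2.+1} -> 'I_n.*2.+1 * 'I_n.*2.+1 * 'I_n.*2.+1)
    (o_orient : is_orientation E o)
    (es : seq {set 'I_n.*2.+1}) (es_enum : perm_eq es (enum E))
    (r : 'I_n.*2.+1) :
  (forall B : {set {set 'I_n.*2.+1}},
     parity_base (row' r (incidence K o es)) (@hyperedge_line _ es) E B <->
     spanning_hypertree E B) /\
  (three_pfaffian E o ->
   exists c : K,
     pfaffian_parity (row' r (incidence K o es)) (@hyperedge_line _ es) E c /\
     (* r is numbered from 0 *)
     forall T, spanning_hypertree E T ->
       c = (-1) ^+ r * (hypertree_sgn o T)%:~R).
Proof.
have baseP B : parity_base (row' r (incidence K o es)) (@hyperedge_line _ es) E B <->
    spanning_hypertree E B.
  have [sBE|nBE] := boolP (B \subset E).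
    exact: (@parity_base_hypertree K n n_gt0 E E3 o o_orient es es_enum).
  by split=> [[]|[]]; rewrite (negPf nBE).
split=> // pfaff.
have sgn_neq0 T : (-1) ^+ r * (hypertree_sgn o T)%:~R != 0 :> K.
  rewrite mulf_neq0 ?signr_eq0 // /hypertree_sgn.
  by case: pickP => [x _|_]; rewrite ?rmorphXn ?rmorphN1 ?signr_eq0 ?oner_neq0.
(* The constant comes from one chosen spanning hypertree; whether there is one is decided by the
   Boolean rank condition. *)
have [/existsP[T0 /andP[sT0 free0]]|none] := boolP [exists T : {set {set 'I_n.*2.+1}},
    (T \subset E) && (let M := col_submx (row' r (incidence K o es))
       (line_cols (@hyperedge_line _ es) T) in row_free M && row_free M^T)].
  have T0P : spanning_hypertree E T0 by apply/baseP/parity_baseP.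
  exists ((-1) ^+ r * (hypertree_sgn o T0)%:~R); split; last first.
    by move=> T TP; rewrite (pfaff T0 T).
  split=> // B /baseP BP sq; rewrite (pfaff T0 B) //.
  by apply: (@det_base K n E E3 o o_orient es es_enum) => //; case: BP.
have noT T : ~ spanning_hypertree E T.
  move/baseP/parity_baseP=> [sTE freeT]; case/negP: none.
  by apply/existsP; exists T; rewrite sTE.
(* Without spanning hypertrees both claims are vacuous, and any nonzero constant serves. *)
exists 1; split=> [|T /noT//]; split; first exact: oner_neq0.
by move=> B /baseP/noT.
Qed.
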